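(* Let $X$ be a compactum (compact metric space) with $\operatorname{cat}_g X\le m$. Then $\operatorname{cup\text{-}length}_R X\le m$ for any commutative ring $R$.
   Context: A subset $A\subset X$ is contractible in $X$ if the inclusion map $A\to X$ is homotopic to a constant map. The general LS-category $\operatorname{cat}_g X$ is the smallest integer $k$ such that $X=\bigcup_{i=0}^{k}A_i$, where each $A_i$ is an arbitrary subset of $X$ contractible in $X$ (infinite if no such $k$ exists). For a commutative ring $R$, the $R$-cup-length $\operatorname{cup\text{-}length}_R X$ is the smallest integer $k$ such that all cup-products $\alpha_0\smile\alpha_1\smile\dots\smile\alpha_k$ of length $k+1$, with $\alpha_i\in H^{k_i}(X;R)$ and $k_i>0$, vanish in the Čech cohomology of $X$ with coefficients in $R$. *)

(* Defs.v *)
From HB Require Import structures.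
From mathcomp Require Import all_boot all_order all_algebra.
From mathcomp Require Import generic_quotient.
From mathcomp Require Import boolp classical_sets functions reals topology.
From mathcomp Require Import normedtype.
From mathcomp Require Import ring.

Set Implicit Arguments.
Unset Strict Implicit.
Unset Printing Implicit Defensive.

Import Order.TTheory GRing.Theory Num.Theory.
Import numFieldNormedType.Exports.

Local Open Scope classical_set_scope.
Local Open Scope ring_scope.
Local Open Scope quotient_scope.

(* None stands for infinity. *)
Definition least (P : set nat) : option nat :=
  if pselect (exists n, `[< P n >]) is left exP then Some (ex_minn exP)
  else None.

Definition enat_le (o : option nat) (m : nat) : bool :=
  if o is Some k then (k <= m)%N else false.

(* [f] and [g] only matter on [A]: this is homotopy of their restrictions to
   the subspace [A], with the unit interval taken in [K]. *)
Definition homotopic_on (K : realType) (X Y : topologicalType) (A : set X)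
    (f g : X -> Y) : Prop :=
  exists H : X * K -> Y,
    [/\ {within A `*` `[0, 1], continuous H},
        forall a, A a -> H (a, 0) = f a &
        forall a, A a -> H (a, 1) = g a].

Definition contractible_in (K : realType) (X : topologicalType) (A : set X) :
    Prop :=
  exists f : X -> X,
    (forall a b, A a -> A b -> f a = f b) /\ homotopic_on K A id f.

Definition cat_g (K : realType) (X : topologicalType) : option nat :=
  least [set k | exists A : 'I_k.+1 -> set X,
    (forall i, contractible_in K (A i)) /\ \bigcup_i A i = [set: X]].

(* An ordered n-simplex is a sequence of n+1 vertices, repetitions allowed.  A
   cochain is represented by a total function on sequences of vertices; in
   degree n only its values on the n-simplices of the complex at hand count:
   being a cocycle or a coboundary is tested on simplices only (see
   [is_cocycle] and [is_coboundary] below). *)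
Section Cochains.
Context {V : Type} {R : comPzRingType}.
Implicit Types (c e : seq V -> R) (s : seq V).

Definition face (i : nat) s : seq V := take i s ++ drop i.+1 s.

Definition coboundary c s : R := \sum_(i < size s) (-1) ^+ i * c (face i s).

(* Front p-face times back face (Alexander-Whitney). *)
Definition cup_cochain (p : nat) c e s : R := c (take p.+1 s) * e (drop p s).

Lemma coboundary_nil c : coboundary c [::] = 0.
Proof. by rewrite /coboundary big_ord0. Qed.

Lemma coboundary_cons c x s :
  coboundary c (x :: s) = c s - coboundary (fun t => c (x :: t)) s.
Proof.
rewrite /coboundary /= big_ord_recl /= expr0 mul1r /face /=.
rewrite drop0; congr (_ + _); rewrite -sumrN; apply: eq_bigr => i _.
by rewrite /bump /= add1n exprS -mulrA mulN1r.
Qed.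

Lemma eq_coboundary c e : c =1 e -> coboundary c =1 coboundary e.
Proof. by move=> ce s; apply: eq_bigr => i _; rewrite ce. Qed.

Lemma coboundaryB c e s :
  coboundary (fun t => c t - e t) s = coboundary c s - coboundary e s.
Proof.
by rewrite /coboundary -sumrB; apply: eq_bigr => i _; rewrite mulrBr.
Qed.

Lemma coboundaryD c e s :
  coboundary (fun t => c t + e t) s = coboundary c s + coboundary e s.
Proof.
by rewrite /coboundary -big_split; apply: eq_bigr => i _; rewrite mulrDr.
Qed.

Lemma coboundaryZ (a : R) c s :
  coboundary (fun t => a * c t) s = a * coboundary c s.
Proof.
by rewrite /coboundary mulr_sumr; apply: eq_bigr => i _; rewrite mulrCA.
Qed.

Lemma coboundary_cup p c e s : (p.+1 < size s)%N ->
  coboundary (cup_cochain p c e) s =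
  cup_cochain p.+1 (coboundary c) e s +
  (-1) ^+ p * cup_cochain p c (coboundary e) s.
Proof.
elim: p c s => [|p IHp] c [//|x t] /=; rewrite ltnS => st.
  rewrite coboundary_cons.
  have -> : coboundary (fun u => cup_cochain 0 c e (x :: u)) t =
            c [:: x] * coboundary (fun u => e (x :: u)) t.
    rewrite -coboundaryZ; apply: eq_coboundary => u.
    by rewrite /cup_cochain /= take0.
  case: t st => [//|y t] _.
  rewrite /cup_cochain /= ?take0 ?drop0 !coboundary_cons coboundary_nil.
  by ring.
rewrite coboundary_cons.
have -> : coboundary (fun u => cup_cochain p.+1 c e (x :: u)) t =
          coboundary (cup_cochain p (fun u => c (x :: u)) e) t by [].
rewrite IHp // /cup_cochain /= coboundary_cons exprS.
by ring.
Qed.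

End Cochains.

Lemma coboundary_map (V W : Type) (R : comPzRingType) (f : V -> W)
    (c : seq W -> R) (s : seq V) :
  coboundary (fun t => c (map f t)) s = coboundary c (map f s).
Proof.
rewrite /coboundary size_map; apply: eq_bigr => i _.
by rewrite /face map_cat map_take map_drop.
Qed.

Section Prism.
Context {V W : Type} {R : comPzRingType} (f g : V -> W).

Fixpoint prism (c : seq W -> R) (s : seq V) : R :=
  if s is x :: t then
    c (f x :: map g s) - prism (fun u => c (f x :: u)) t
  else 0.

Lemma prismB c e s :
  prism (fun u => c u - e u) s = prism c s - prism e s.
Proof.
by elim: s c e => [|x s IHs] c e /=; rewrite ?subrr // IHs; ring.
Qed.

Lemma eq_prism c e : c =1 e -> prism c =1 prism e.
Proof.
move=> ce s; elim: s c e ce => [//|x s IHs] c e ce /=.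
by rewrite ce; congr (_ - _); apply: IHs => u.
Qed.

Lemma prism_homotopy c s :
  coboundary (prism c) s + prism (coboundary c) s =
  c (map g s) - c (map f s).
Proof.
elim: s c => [|x t IHt] c; first by rewrite coboundary_nil /= addr0 subrr.
rewrite coboundary_cons /=.
rewrite (coboundaryB (fun u => c (f x :: g x :: map g u))).
rewrite (coboundary_map g (fun u => c (f x :: g x :: u))).
rewrite !coboundary_cons.
rewrite (eq_prism (coboundary_cons c (f x))) prismB.
have /eqP := IHt (fun u => c (f x :: u)).
rewrite addrC -subr_eq opprB => /eqP <-.
by ring.
Qed.

End Prism.

Section Nerve.
Context {X : topologicalType} {R : comPzRingType}.
Implicit Types (U V W : set (set X)) (c e : seq (set X) -> R).
Implicit Types (s t : seq (set X)) (p q : set X -> set X).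

Definition open_cover U : Prop :=
  (forall u, U u -> open u) /\ \bigcup_(u in U) u = [set: X].

Definition nerve_simplex U (n : nat) s : Prop :=
  [/\ size s = n.+1, forall u, u \in s -> U u &
      exists x : X, forall u, u \in s -> u x].

Definition is_cocycle U (n : nat) c : Prop :=
  forall s, nerve_simplex U n.+1 s -> coboundary c s = 0.

Definition is_coboundary U (n : nat) c : Prop :=
  if n is _.+1 then
    exists b : seq (set X) -> R,
      forall s, nerve_simplex U n s -> c s = coboundary b s
  else forall s, nerve_simplex U 0 s -> c s = 0.

Definition refinement_map W U p : Prop :=
  forall w, W w -> U (p w) /\ w `<=` p w.

Definition meet_cover U V : set (set X) :=
  [set u `&` v | u in U & v in V].

Definition meet_left U V (w : set X) : set X :=
  xget setT [set u | U u /\ exists2 v, V v & u `&` v = w].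

Definition meet_right U V (w : set X) : set X :=
  xget setT [set v | V v /\ exists2 u, U u & u `&` v = w].

Lemma open_cover1 : open_cover [set [set: X]].
Proof.
by split=> [u ->|]; [exact: openT | rewrite bigcup_set1].
Qed.

Lemma open_cover_meet U V :
  open_cover U -> open_cover V -> open_cover (meet_cover U V).
Proof.
move=> [oU cU] [oV cV]; split.
  by move=> w [u Uu [v Vv <-]]; apply: openI; [exact: oU | exact: oV].
apply/seteqP; split=> // x _.
have [u Uu ux] : (\bigcup_(u in U) u) x by rewrite cU.
have [v Vv vx] : (\bigcup_(u in V) u) x by rewrite cV.
by exists (u `&` v) => //; exists u => //; exists v.
Qed.

Lemma meet_leftP U V : refinement_map (meet_cover U V) U (meet_left U V).
Proof.
move=> w [u Uu [v Vv uvw]]; rewrite /meet_left; case: xgetP => [u' _ [Uu' [v' _ <-]]|].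
  by split=> // x [].
by move=> /(_ u); case; split=> //; exists v.
Qed.

Lemma meet_rightP U V : refinement_map (meet_cover U V) V (meet_right U V).
Proof.
move=> w [u Uu [v Vv uvw]]; rewrite /meet_right; case: xgetP => [v' _ [Vv' [u' _ <-]]|].
  by split=> // x [].
by move=> /(_ v); case; split=> //; exists u.
Qed.

Lemma refinement_id U : refinement_map U U id.
Proof. by move=> w Uw; split. Qed.

Lemma refinement_comp U V W p q :
  refinement_map W V q -> refinement_map V U p -> refinement_map W U (p \o q).
Proof.
move=> rq rp w /rq [Vq wq]; have [Up qp] := rp _ Vq.
by split=> //=; exact: subset_trans qp.
Qed.

Lemma nerve_simplex_map W U p n s : refinement_map W U p ->
  nerve_simplex W n s -> nerve_simplex U n (map p s).
Proof.
move=> rp [sn sW [x sx]]; split; first by rewrite size_map.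
  by move=> _ /mapP [w ws ->]; have [] := rp _ (sW _ ws).
exists x => _ /mapP [w ws ->]; have [_] := rp _ (sW _ ws); apply; exact: sx.
Qed.

Lemma nerve_simplex_sub U n m s t : nerve_simplex U n s ->
  {subset t <= s} -> size t = m.+1 -> nerve_simplex U m t.
Proof.
move=> [_ sU [x sx]] ts tm; split=> // [u /ts/sU //|].
by exists x => u /ts/sx.
Qed.

Lemma nerve_simplex_take U n m s : nerve_simplex U n s -> (m <= n)%N ->
  nerve_simplex U m (take m.+1 s).
Proof.
move=> ss mn; have [sn _ _] := ss.
apply: nerve_simplex_sub ss _ _; first exact: mem_take.
by rewrite size_takel // sn.
Qed.

Lemma nerve_simplex_drop U n m k s : nerve_simplex U n s ->
  (n = m + k)%N -> nerve_simplex U k (drop m s).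
Proof.
move=> ss nmk; have [sn _ _] := ss.
apply: nerve_simplex_sub ss _ _; first exact: mem_drop.
by rewrite size_drop sn nmk -addnS addKn.
Qed.

Lemma is_coboundaryP U n c : is_coboundary U n c <->
  exists b : seq (set X) -> R, (n = 0%N -> b [::] = 0) /\
    forall s, nerve_simplex U n s -> c s = coboundary b s.
Proof.
case: n => [|n] /=; last by split=> [[b bc]|[b [_ bc]]]; exists b.
split=> [c0|[b [/(_ erefl) b0 bc]] s ss].
  exists (fun=> 0); split=> // s /c0 ->.
  by rewrite /coboundary big1 // => i _; rewrite mulr0.
rewrite bc //; case: s ss => [[//]|u [|v s] [//= _ _ _]].
by rewrite coboundary_cons coboundary_nil subr0.
Qed.

Lemma is_coboundary_ext U n c e :
  (forall s, nerve_simplex U n s -> c s = e s) ->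
  is_coboundary U n c -> is_coboundary U n e.
Proof.
move=> ce /is_coboundaryP [b [b0 bc]]; apply/is_coboundaryP; exists b.
by split=> // s ss; rewrite -ce // bc.
Qed.

Lemma is_coboundary0 U n : is_coboundary U n (fun=> 0).
Proof.
apply/is_coboundaryP; exists (fun=> 0); split=> // s _.
by rewrite /coboundary big1 // => i _; rewrite mulr0.
Qed.

Lemma is_coboundaryB U n c e : is_coboundary U n c -> is_coboundary U n e ->
  is_coboundary U n (fun s => c s - e s).
Proof.
move=> /is_coboundaryP [b [b0 bc]] /is_coboundaryP [a [a0 ae]].
apply/is_coboundaryP; exists (fun s => b s - a s); split.
  by move=> n0; rewrite b0 // a0 // subrr.
by move=> s ss; rewrite coboundaryB bc // ae.
Qed.

Lemma is_coboundaryN U n c : is_coboundary U n c ->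
  is_coboundary U n (fun s => - c s).
Proof.
move=> /(is_coboundaryB (is_coboundary0 U n)).
by apply: is_coboundary_ext => s _; rewrite sub0r.
Qed.

Lemma is_coboundaryD U n c e : is_coboundary U n c -> is_coboundary U n e ->
  is_coboundary U n (fun s => c s + e s).
Proof.
move=> bc /is_coboundaryN be; have := is_coboundaryB bc be.
by apply: is_coboundary_ext => s _; rewrite opprK.
Qed.

Lemma is_coboundary_map W U p n c : refinement_map W U p ->
  is_coboundary U n c -> is_coboundary W n (c \o map p).
Proof.
move=> rp /is_coboundaryP [b [b0 bc]]; apply/is_coboundaryP.
exists (b \o map p); split=> // s ss.
by rewrite coboundary_map /= bc //; exact: nerve_simplex_map ss.
Qed.

Lemma is_cocycle_map W U p n c : refinement_map W U p ->
  is_cocycle U n c -> is_cocycle W n (c \o map p).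
Proof.
move=> rp cc s ss; rewrite (coboundary_map p c) cc //.
exact: nerve_simplex_map ss.
Qed.

Lemma prism_eq0 p q c s :
  (forall t, size t = (size s).+1 -> {subset t <= map p s ++ map q s} ->
    c t = 0) -> prism p q c s = 0.
Proof.
elim: s c => [//|x s IHs] c c0 /=; rewrite IHs ?subr0.
  apply: c0; first by rewrite /= size_map.
  move=> u; rewrite !inE !mem_cat !inE => /orP [->//|/orP [->|->]];
  by rewrite !orbT.
move=> t ts tsub; apply: c0; first by rewrite /= ts.
move=> u; rewrite !inE !mem_cat !inE => /orP [->//|/tsub].
by rewrite mem_cat => /orP [->|->]; rewrite !orbT.
Qed.

Lemma refinement_unique W U p q n c :
  refinement_map W U p -> refinement_map W U q -> is_cocycle U n c ->
  is_coboundary W n (fun s => c (map p s) - c (map q s)).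
Proof.
move=> rp rq cc; apply/is_coboundaryP; exists (prism q p c); split=> // s ss.
rewrite -prism_homotopy prism_eq0 ?addr0 // => t st tsub; apply: cc.
have [sn sW [x sx]] := ss; split; first by rewrite st sn.
  move=> u /tsub; rewrite mem_cat => /orP [] /mapP [w ws ->].
    by have [] := rq _ (sW _ ws).
  by have [] := rp _ (sW _ ws).
exists x => u /tsub; rewrite mem_cat => /orP [] /mapP [w ws ->].
  by have [_] := rq _ (sW _ ws); apply; exact: sx.
by have [_] := rp _ (sW _ ws); apply; exact: sx.
Qed.

Lemma is_cocycle_cup U n m c e : is_cocycle U n c -> is_cocycle U m e ->
  is_cocycle U (n + m) (cup_cochain n c e).
Proof.
move=> cc ce s ss; have [sn _ _] := ss.
rewrite coboundary_cup ?sn ?ltnS ?leq_addr // /cup_cochain.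
rewrite cc ?mul0r ?ce ?mulr0 ?addr0 //.
  by apply: nerve_simplex_drop ss _; rewrite addnS.
by apply: nerve_simplex_take ss _; rewrite ltnS leq_addr.
Qed.

Lemma is_coboundary_cupl U n m c e : is_coboundary U n c -> is_cocycle U m e ->
  is_coboundary U (n + m) (cup_cochain n c e).
Proof.
case: n => [|n] bc ce; apply/is_coboundaryP.
  exists (fun=> 0); split=> // s ss.
  rewrite /cup_cochain bc ?mul0r; last exact: nerve_simplex_take ss _.
  by rewrite /coboundary big1 // => i _; rewrite mulr0.
case: bc => b bc; exists (cup_cochain n b e); split=> // s ss.
have [sn _ _] := ss.
rewrite coboundary_cup ?sn ?ltnS ?addSn ?ltnS ?leq_addr // /cup_cochain.
rewrite [X in (-1) ^+ n * (_ * X)]ce ?mulr0 ?addr0.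
  by rewrite bc //; apply: nerve_simplex_take ss _; rewrite leq_addr.
by apply: nerve_simplex_drop ss _; rewrite addSn addnS.
Qed.

Lemma is_coboundary_cupr U n m c e : is_cocycle U n c -> is_coboundary U m e ->
  is_coboundary U (n + m) (cup_cochain n c e).
Proof.
move=> cc; case: m => [|m] be; apply/is_coboundaryP.
  exists (fun=> 0); split=> // s ss.
  rewrite /cup_cochain be ?mulr0; last exact: nerve_simplex_drop ss _.
  by rewrite /coboundary big1 // => i _; rewrite mulr0.
case: be => b be; exists (fun s => (-1) ^+ n * cup_cochain n c b s).
split=> [|s ss]; first by rewrite addnS.
have [sn _ _] := ss.
rewrite coboundaryZ coboundary_cup ?sn ?addnS ?ltnS ?leq_addr // /cup_cochain.
rewrite [X in X * _ + _]cc ?mul0r ?add0r.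
  rewrite signrMK be //; exact: nerve_simplex_drop ss _.
by apply: nerve_simplex_take ss _; rewrite addnS ltnS leq_addr.
Qed.

Lemma is_coboundary_cupB U n m c c' e e' :
  is_cocycle U n c' -> is_cocycle U m e ->
  is_coboundary U n (fun s => c s - c' s) ->
  is_coboundary U m (fun s => e s - e' s) ->
  is_coboundary U (n + m)
    (fun s => cup_cochain n c e s - cup_cochain n c' e' s).
Proof.
move=> cc' ce bc be.
have := is_coboundaryD (is_coboundary_cupl bc ce) (is_coboundary_cupr cc' be).
by apply: is_coboundary_ext => s _; rewrite /cup_cochain; ring.
Qed.

End Nerve.

Record cech_rep (X : topologicalType) (R : comPzRingType) (n : nat) :=
  CechRep {
    rep_cover : set (set X);
    rep_cochain : seq (set X) -> R;
    rep_coverP : open_cover rep_cover;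
    rep_cocycleP : is_cocycle rep_cover n rep_cochain
  }.
Arguments rep_coverP {X R n} c.
Arguments rep_cocycleP {X R n} c.

HB.instance Definition _ X R n := gen_eqMixin (cech_rep X R n).
HB.instance Definition _ X R n := gen_choiceMixin (cech_rep X R n).

Section Cech.
Context {X : topologicalType} {R : comPzRingType}.

(* Two cocycles have the same class in the colimit when their classes agree in
   the cohomology of the nerve of some common refinement. *)
Definition same_class n (x y : cech_rep X R n) : Prop :=
  exists W p q,
    [/\ open_cover W, refinement_map W (rep_cover x) p,
        refinement_map W (rep_cover y) q &
        is_coboundary W n
          (fun s => rep_cochain x (map p s) - rep_cochain y (map q s))].

Lemma same_class_refine n (x y : cech_rep X R n) W p q T r p' q' :
  refinement_map W (rep_cover x) p -> refinement_map W (rep_cover y) q ->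
  is_coboundary W n
    (fun s => rep_cochain x (map p s) - rep_cochain y (map q s)) ->
  refinement_map T W r ->
  refinement_map T (rep_cover x) p' -> refinement_map T (rep_cover y) q' ->
  is_coboundary T n
    (fun s => rep_cochain x (map p' s) - rep_cochain y (map q' s)).
Proof.
move=> rp rq b rr rp' rq'.
have bx := refinement_unique rp' (refinement_comp rr rp) (rep_cocycleP x).
have by_ := refinement_unique (refinement_comp rr rq) rq' (rep_cocycleP y).
have bb := is_coboundaryD (is_coboundaryD bx (is_coboundary_map rr b)) by_.
apply: is_coboundary_ext bb => s _.
by rewrite /= (map_comp p r) (map_comp q r) !addrA !subrK.
Qed.

Lemma same_class_refl n (x : cech_rep X R n) : same_class x x.
Proof.
exists (rep_cover x), id, id; split; [exact: rep_coverP | exact: refinement_id..|].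
by apply: is_coboundary_ext (is_coboundary0 _ _) => s _; rewrite subrr.
Qed.

Lemma same_class_sym n (x y : cech_rep X R n) :
  same_class x y -> same_class y x.
Proof.
move=> [W [p [q [cW rp rq b]]]]; exists W, q, p; split=> //.
by apply: is_coboundary_ext (is_coboundaryN b) => s _; rewrite opprB.
Qed.

Lemma same_class_trans n (y x z : cech_rep X R n) :
  same_class x y -> same_class y z -> same_class x z.
Proof.
move=> [W [p [q [cW rp rq b]]]] [W' [p' [q' [cW' rp' rq' b']]]].
pose l := meet_left W W'; pose r := meet_right W W'.
have rl : refinement_map (meet_cover W W') W l by exact: meet_leftP.
have rr : refinement_map (meet_cover W W') W' r by exact: meet_rightP.
exists (meet_cover W W'), (p \o l), (q' \o r); split.
- exact: open_cover_meet.
- exact: refinement_comp rl rp.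
- exact: refinement_comp rr rq'.
have b1 := same_class_refine rp rq b rl
  (refinement_comp rl rp) (refinement_comp rl rq).
have b2 := same_class_refine rp' rq' b' rr
  (refinement_comp rl rq) (refinement_comp rr rq').
have bb := is_coboundaryD b1 b2.
apply: is_coboundary_ext bb => s _.
by rewrite /= !addrA !subrK.
Qed.

Definition same_classb n (x y : cech_rep X R n) : bool := `[< same_class x y >].

Lemma same_classb_equiv n : equiv_class_of (@same_classb n).
Proof.
split.
- by move=> x; apply/asboolP; exact: same_class_refl.
- by move=> x y; apply/asboolP/asboolP; exact: same_class_sym.
- move=> y x z /asboolP xy /asboolP yz; apply/asboolP.
  exact: same_class_trans xy yz.
Qed.

Canonical same_class_equiv n := EquivRelPack (@same_classb_equiv n).

End Cech.

Definition cech (X : topologicalType) (R : comPzRingType) (n : nat) : Type :=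
  {eq_quot (@same_class_equiv X R n)}.

Section CechOperations.
Context {X : topologicalType} {R : comPzRingType}.

Lemma cech_eqP n (x y : cech_rep X R n) :
  \pi_(cech X R n) x = \pi_(cech X R n) y <-> same_class x y.
Proof.
split=> [/eqmodP /asboolP //|xy]; apply/eqmodP; exact/asboolP.
Qed.

Lemma is_cocycle0 (U : set (set X)) n :
  is_cocycle U n (fun=> 0 : R).
Proof.
by move=> s _; rewrite /coboundary big1 // => i _; rewrite mulr0.
Qed.

Definition cech0 n : cech X R n :=
  \pi_(cech X R n) (CechRep open_cover1 (@is_cocycle0 [set [set: X]] n)).

Definition cup_rep n m (x : cech_rep X R n) (y : cech_rep X R m) :
    cech_rep X R (n + m) :=
  let U := rep_cover x in
  let V := rep_cover y in
  CechRep (open_cover_meet (rep_coverP x) (rep_coverP y))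
    (is_cocycle_cup (is_cocycle_map (@meet_leftP X U V) (rep_cocycleP x))
                    (is_cocycle_map (@meet_rightP X U V) (rep_cocycleP y))).

Definition cech_cup n m (a : cech X R n) (b : cech X R m) : cech X R (n + m) :=
  \pi_(cech X R (n + m)) (cup_rep (repr a) (repr b)).

Lemma same_class_cup n m (x x' : cech_rep X R n) (y y' : cech_rep X R m) :
  same_class x x' -> same_class y y' ->
  same_class (cup_rep x y) (cup_rep x' y').
Proof.
move=> [W [p [q [cW rp rq b]]]] [W' [p' [q' [cW' rp' rq' b']]]].
pose C := meet_cover (rep_cover x) (rep_cover y).
pose C' := meet_cover (rep_cover x') (rep_cover y').
pose T1 := meet_cover C C'; pose T2 := meet_cover W W'; pose T := meet_cover T1 T2.
have r1 : refinement_map T T1 _ := @meet_leftP X T1 T2.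
have r2 : refinement_map T T2 _ := @meet_rightP X T1 T2.
have rC := refinement_comp r1 (@meet_leftP X C C').
have rC' := refinement_comp r1 (@meet_rightP X C C').
have rW := refinement_comp r2 (@meet_leftP X W W').
have rW' := refinement_comp r2 (@meet_rightP X W W').
have rx := refinement_comp rC (@meet_leftP X (rep_cover x) (rep_cover y)).
have ry := refinement_comp rC (@meet_rightP X (rep_cover x) (rep_cover y)).
have rx' := refinement_comp rC' (@meet_leftP X (rep_cover x') (rep_cover y')).
have ry' := refinement_comp rC' (@meet_rightP X (rep_cover x') (rep_cover y')).
exists T; eexists; eexists; split; [|exact: rC|exact: rC'|].
  by do !apply: open_cover_meet => //; exact: rep_coverP.
have bx := same_class_refine rp rq b rW rx rx'.
have by_ := same_class_refine rp' rq' b' rW' ry ry'.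
have bb := is_coboundary_cupB (is_cocycle_map rx' (rep_cocycleP x'))
  (is_cocycle_map ry (rep_cocycleP y)) bx by_.
apply: is_coboundary_ext bb => s _.
rewrite /= /cup_cochain /= -!map_take -!map_drop.
by rewrite -!map_comp.
Qed.

Lemma cech_cup_pi n m (x : cech_rep X R n) (y : cech_rep X R m) :
  cech_cup (\pi_(cech X R n) x) (\pi_(cech X R m) y) =
  \pi_(cech X R (n + m)) (cup_rep x y).
Proof.
by apply/cech_eqP/same_class_cup; apply/cech_eqP; rewrite reprK.
Qed.

End CechOperations.

Definition hclass (X : topologicalType) (R : comPzRingType) : Type :=
  {n : nat & cech X R n}.

Definition hdeg X R (a : hclass X R) : nat := projT1 a.

Definition hcup X R (a b : hclass X R) : hclass X R :=
  existT _ (hdeg a + hdeg b)%N (cech_cup (projT2 a) (projT2 b)).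

Definition hcup_prod X R k (a : 'I_k.+1 -> hclass X R) : hclass X R :=
  foldl (@hcup X R) (a ord0) [seq a (lift ord0 i) | i <- enum 'I_k].

Definition cup_length (R : comPzRingType) (X : topologicalType) : option nat :=
  least [set k | forall a : 'I_k.+1 -> hclass X R,
    (forall i, 0 < hdeg (a i))%N ->
    projT2 (hcup_prod a) = cech0 (hdeg (hcup_prod a))].

(* Main.v *)
Require Import Defs.
From mathcomp Require Import all_boot all_order all_algebra.
From mathcomp Require Import generic_quotient.
From mathcomp Require Import boolp classical_sets reals topology.
From mathcomp Require Import normedtype.
From mathcomp Require Import ring lra zify.

(* A null-homotopy of an arbitrary subset A kills the restriction of a class of
   positive degree to A, and even to an open neighbourhood of A: a cover of A by
   small relatively open sets can be thickened to balls of X without creating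
   simplices that A does not control.  When A is not compact, the number of time
   steps needed to follow the homotopy through a given cover is not bounded, so
   each ball gets its own dyadic number of steps; the chain homotopy on a
   simplex uses any common refinement of the steps of its vertices, and does not
   depend on the refinement.
   If a vanishes near A and b near B, they are represented by cocycles vanishing
   on the simplices of a neighbourhood of A, resp. of B; on a star-refined cover
   every simplex lies in one of the two neighbourhoods, so the cup product of a
   and b vanishes near the union of A and B.  With m + 1 contractible sets
   covering X, a product of m + 1 classes vanishes on all of X. *)

Set Implicit Arguments.
Unset Strict Implicit.
Unset Printing Implicit Defensive.

Import Order.TTheory GRing.Theory Num.Theory.
Import numFieldNormedType.Exports.

Local Open Scope classical_set_scope.
Local Open Scope ring_scope.
Local Open Scope quotient_scope.

(** * Chain homotopies along discrete paths of vertex maps *)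

Section Paths.
Context {V W : Type} {R : comPzRingType}.
Implicit Types (P : nat -> V -> W) (c : seq W -> R) (s : seq V).

Lemma eq_prism_map (p p' q q' : V -> W) c s :
  map p s = map p' s -> map q s = map q' s ->
  prism p q c s = prism p' q' c s.
Proof.
elim: s c => [//|x s IHs] c /= [px ps] [qx qs].
by rewrite px qx qs IHs.
Qed.

(* Subtracting the prism of a map with itself, which is a homotopy from that
   map to itself, makes stationary steps contribute exactly 0. *)
Definition path_prism P (N : nat) c s : R :=
  \sum_(j < N) (prism (P j) (P j.+1) c s - prism (P j) (P j) c s).

Lemma path_prism_homotopy P N c s :
  coboundary (path_prism P N c) s + path_prism P N (coboundary c) s =
  c (map (P N) s) - c (map (P 0%N) s).
Proof.
elim: N => [|N IHN].
  rewrite /path_prism big_ord0 addr0 subrr /coboundary big1 // => i _.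
  by rewrite big_ord0 mulr0.
rewrite (eq_coboundary (e := fun t => path_prism P N c t +
  (prism (P N) (P N.+1) c t - prism (P N) (P N) c t))); last first.
  by move=> t; rewrite /path_prism big_ord_recr.
rewrite coboundaryD coboundaryB {2}/path_prism big_ord_recr /=.
rewrite -/(path_prism P N (coboundary c) s).
have := prism_homotopy (P N) (P N.+1) c s.
have := prism_homotopy (P N) (P N) c s.
rewrite subrr => e2 e1.
apply: (@etrans _ _ ((c (map (P N) s) - c (map (P 0%N) s)) +
  (c (map (P N.+1) s) - c (map (P N) s)) - 0)); last by ring.
by rewrite -IHN -e2 -e1; ring.
Qed.

(** Every second step of the doubled path is stationary and contributes 0. The [N.+1] positions
    become [N.*2.+2], hence [N.*2.+1] steps. *)
Lemma path_prism_double P N c s :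
  path_prism (fun j => P j./2) N.*2.+1 c s = path_prism P N c s.
Proof.
rewrite /path_prism; elim: N => [|N IHN].
  by rewrite big_ord_recr !big_ord0 /= subrr addr0.
rewrite doubleS 2!big_ord_recr IHN [in RHS]big_ord_recr /=.
by rewrite uphalf_double doubleK subrr addr0.
Qed.

Lemma coboundaryK c : coboundary (coboundary c) =1 fun=> 0.
Proof.
move=> s; elim: s c => [|x s IHs] c; first exact: coboundary_nil.
rewrite coboundary_cons.
rewrite (eq_coboundary (coboundary_cons c x)).
by rewrite coboundaryB IHs subr0 subrr.
Qed.

End Paths.

(** * Contiguous vertex maps and dyadic paths in nerves *)

Section NerveHomotopy.
Context {X : topologicalType} {R : comPzRingType}.
Implicit Types (U V : set (set X)) (c e : seq (set X) -> R).
Implicit Types (s : seq (set X)) (p q : set X -> set X).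

(** The prism only meets the vertices [p w] and [q w]. Their common point [x] may lie outside the
    members of [s], so [p] and [q] may carry sets along a homotopy. *)
Lemma prism_cocycle U V p q n c s :
  (forall w, V w -> U (p w) /\ U (q w)) ->
  (exists x : X, forall w, w \in s -> p w x /\ q w x) ->
  is_cocycle U n c -> nerve_simplex V n s ->
  prism p q (coboundary c) s = 0.
Proof.
move=> pqU [x sx] cc [sn sV _]; apply: prism_eq0 => t st tsub; apply: cc.
split; first by rewrite st sn.
  by move=> u /tsub; rewrite mem_cat => /orP [] /mapP [w /sV /pqU [? ?] ->].
by exists x => u /tsub; rewrite mem_cat => /orP [] /mapP [w /sx [? ?] ->].
Qed.

Lemma contiguous_coboundary U V p q n c :
  (forall w, V w -> U (p w) /\ U (q w)) ->
  (forall s, nerve_simplex V n s ->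
    exists x : X, forall w, w \in s -> p w x /\ q w x) ->
  is_cocycle U n c ->
  is_coboundary V n (fun s => c (map q s) - c (map p s)).
Proof.
move=> pqU pqx cc; apply/is_coboundaryP; exists (prism p q c); split=> // s ss.
by rewrite -prism_homotopy (prism_cocycle pqU (pqx s ss) cc ss) addr0.
Qed.

(** This is the cohomology of a point. In even degree a constant cochain is its own coboundary; in
    odd degree the cocycle condition on a simplex with all vertices [u] makes the value 0. *)
Lemma is_coboundary_const U V u n c : U u -> u !=set0 -> (0 < n)%N ->
  is_cocycle U n c -> is_coboundary V n (fun s => c (map (fun=> u) s)).
Proof.
case: n => // n Uu [x ux] _ cc.
have alt (a : R) m : \sum_(i < m) (-1) ^+ i * a = (odd m)%:R * a.
  elim: m => [|m IHm]; first by rewrite big_ord0 mul0r.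
  rewrite big_ord_recr IHm /= -signr_odd -mulrDl.
  by case: (odd m); rewrite /= ?expr1 ?expr0 ?subrr ?add0r ?addrN.
have cob_nseq (e : seq (set X) -> R) m :
    coboundary e (nseq m.+1 u) = (odd m.+1)%:R * e (nseq m u).
  rewrite -alt /coboundary size_nseq; apply: eq_bigr => i _.
  congr (_ * e _); rewrite /face take_nseq ?drop_nseq; last by rewrite ltnW.
  by rewrite -nseqD subSS subnKC // -ltnS.
have mapc s : map (fun=> u) s = nseq (size s) u.
  by elim: s => //= y s ->.
exists (fun=> c (nseq n.+2 u)) => s [sn _ _]; rewrite mapc sn.
have -> : coboundary (fun=> c (nseq n.+2 u)) s =
    (odd n.+2)%:R * c (nseq n.+2 u).
  by rewrite -alt /coboundary sn.
have ss : nerve_simplex U n.+2 (nseq n.+3 u).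
  by split; [rewrite size_nseq|move=> v /nseqP[->]|exists x => v /nseqP[->]].
have := cc _ ss; rewrite cob_nseq /= negbK.
by case: (odd n); rewrite /= !(mulr1n, mulr0n) mul1r ?mul0r // => ->.
Qed.

(* [u w] lists the sets met by a path over 2 ^ k w equal time steps; this is
   the j-th one when the steps are refined to 2 ^ L of them. *)
Definition dyadic_sample (k : set X -> nat) (u : set X -> nat -> set X)
  (L j : nat) (w : set X) : set X := u w (j %/ 2 ^ (L - k w))%N.

Lemma path_prism_sampleS k u L c s : (forall w, w \in s -> k w <= L)%N ->
  path_prism (dyadic_sample k u L.+1) (2 ^ L.+1).-1 c s =
  path_prism (dyadic_sample k u L) (2 ^ L).-1 c s.
Proof.
move=> kL; rewrite -[RHS]path_prism_double.
have -> : ((2 ^ L.+1).-1 = (2 ^ L).-1.*2.+1)%N.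
  by rewrite expnS; have := expn_gt0 2 L; lia.
have E j : map (dyadic_sample k u L.+1 j) s = map (dyadic_sample k u L j./2) s.
  apply/eq_in_map => w ws; rewrite /dyadic_sample subSn ?kL //.
  by rewrite expnS -divn2 divnMA.
rewrite /path_prism; apply: eq_bigr => j _.
by congr (_ - _); apply: eq_prism_map; rewrite E.
Qed.

Lemma path_prism_sample k u L M c s :
  (forall w, w \in s -> k w <= L)%N -> (L <= M)%N ->
  path_prism (dyadic_sample k u M) (2 ^ M).-1 c s =
  path_prism (dyadic_sample k u L) (2 ^ L).-1 c s.
Proof.
move=> kL /subnKC <-; elim: (M - L)%N => [|d IHd]; first by rewrite addn0.
rewrite addnS path_prism_sampleS // => w ws.
by rewrite (leq_trans (kL w ws)) // leq_addr.
Qed.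

Lemma path_coboundary (K : realFieldType) U V k u n c :
  (forall w j, V w -> (j < 2 ^ k w)%N -> U (u w j)) ->
  (forall s, nerve_simplex V n s -> exists h : K -> X,
    forall w (j : nat) (t : K), w \in s -> (j < 2 ^ k w)%N ->
      j%:R <= t * 2 ^+ k w <= j.+1%:R -> u w j (h t)) ->
  is_cocycle U n c ->
  is_coboundary V n
    (fun s => c (map (fun w => u w (2 ^ k w).-1) s) - c (map (u^~ 0%N) s)).
Proof.
move=> uU uh cc; apply/is_coboundaryP.
pose top s := (\max_(w <- s) k w)%N.
have le_top s w : w \in s -> (k w <= top s)%N.
  by move=> ws; rewrite /top (big_rem w ws) /= leq_maxl.
pose F s := path_prism (dyadic_sample k u (top s)) (2 ^ top s).-1 c s.
have FE s L : (forall w, w \in s -> k w <= L)%N ->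
    F s = path_prism (dyadic_sample k u L) (2 ^ L).-1 c s.
  move=> kL; rewrite [RHS](@path_prism_sample k u (top s) L) ?/F //.
    by move=> w ws; exact: le_top.
  by apply/bigmax_leqP_seq => w ws _; exact: kL.
exists F; split=> [_|s ss].
  by rewrite /F /path_prism big1 // => i _; rewrite /= subrr.
have [sn sV _] := ss; set L := top s.
have lt_sample w j : w \in s -> (j < 2 ^ L)%N ->
    (j %/ 2 ^ (L - k w) < 2 ^ k w)%N.
  by move=> ws jL; rewrite ltn_divLR ?expn_gt0 // -expnD subnKC ?le_top.
(* [F] picks a level for each sequence separately, and a face may have a lower one; by [FE] all
   faces can be computed at level [L]. *)
have -> : coboundary F s =
    coboundary (path_prism (dyadic_sample k u L) (2 ^ L).-1 c) s.
  apply: eq_bigr => i _; congr (_ * _); apply: FE => w.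
  by rewrite /face mem_cat => /orP[/mem_take|/mem_drop]; exact: le_top.
have [h hs] := uh s ss.
(* Both ends of a time step are allowed, so the samples [j] and [j.+1] share the point at time
   [j.+1 / 2 ^ L]. *)
have sample_in w j (i : nat) : w \in s -> (j < 2 ^ L)%N -> (j <= i <= j.+1)%N ->
    dyadic_sample k u L j w (h (i%:R / 2 ^+ L)).
  move=> ws jL /andP[ji ij]; apply: hs => //; first exact: lt_sample.
  have kL : (k w <= L)%N := le_top _ _ ws.
  have -> : i%:R / 2 ^+ L * 2 ^+ k w = i%:R / 2 ^+ (L - k w) :> K.
    rewrite -[in 2 ^+ L](subnK kL) exprD invfM mulrA mulfVK //.
    by rewrite expf_neq0 // pnatr_eq0.
  rewrite ler_pdivlMr ?exprn_gt0 // ler_pdivrMr ?exprn_gt0 //.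
  rewrite -natrX -!natrM !ler_nat (leq_trans (leq_divM _ _)) //=.
  by rewrite (leq_trans ij) // -ltn_divLR // expn_gt0.
have := path_prism_homotopy (dyadic_sample k u L) (2 ^ L).-1 c s.
rewrite {2}/path_prism big1 ?addr0 => [->|j _].
  congr (c _ - c _); apply/eq_in_map => w ws; rewrite /dyadic_sample ?div0n //.
  congr (u w _); have kL : (k w <= L)%N := le_top _ _ ws.
  rewrite -[in (2 ^ L)%N](subnK kL) expnD.
  have : (0 < 2 ^ (L - k w))%N by rewrite expn_gt0.
  have : (0 < 2 ^ k w)%N by rewrite expn_gt0.
  set a := (2 ^ (L - k w))%N; set b := (2 ^ k w)%N => b0 a0.
  have -> : ((a * b).-1 = b.-1 * a + a.-1)%N by nia.
  by rewrite divnMDl // divn_small ?addn0 // prednK.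
have jL : (j.+1 < 2 ^ L)%N by have := ltn_ord j; lia.
(* The bound [k w <= L] is known only for vertices of [s]. *)
pose V' := [set w | V w /\ w \in s].
have ss' : nerve_simplex V' n s.
  by case: ss => _ _ sx; split=> // w ws; split=> //; exact: sV.
have mU w : V' w -> forall i, (i < 2 ^ L)%N -> U (dyadic_sample k u L i w).
  by move=> [Vw ws] i iL; apply: uU => //; exact: lt_sample.
by rewrite !(prism_cocycle (U := U) (V := V') (n := n)) ?subr0 //;
  try (move=> w Vw; split; apply: mU => //; exact: ltnW);
  exists (h (j.+1%:R / 2 ^+ L)) => w ws; split; apply: sample_in => //;
  rewrite ?leqnn ?leqnSn // ltnW.
Qed.

End NerveHomotopy.

(** * Metric covers and tracking a null-homotopy *)

Lemma seq_argmax (T : eqType) (K : realDomainType) (f : T -> K) (s : seq T) :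
  s != [::] -> exists2 x, x \in s & forall y, y \in s -> f y <= f x.
Proof.
elim: s => // x s IHs _; have [->|/IHs [z zs zmax]] := eqVneq s [::].
  by exists x; rewrite ?mem_head // => y; rewrite inE => /eqP ->.
have [xz|zx] := leP (f x) (f z).
  exists z; first by rewrite inE zs orbT.
  by move=> y; rewrite inE => /orP[/eqP -> //|/zmax].
exists x; first exact: mem_head.
move=> y; rewrite inE => /orP[/eqP -> //|/zmax fyz].
by rewrite (le_trans fyz) // ltW.
Qed.

Section Metric.
Context {K : realType} {X : pseudoMetricType K} {R : comPzRingType}.
Implicit Types (U V M : set (set X)) (A : set X).

(* Among balls meeting at a point, tripling the largest swallows the others. *)
Lemma star_refinement M : (forall v, M v -> open v) ->
  exists S : set (set X), [/\ forall t, S t -> open t,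
    \bigcup_(v in M) v `<=` \bigcup_(t in S) t &
    forall n s, nerve_simplex S n s ->
      exists2 v, M v & forall t, t \in s -> t `<=` v].
Proof.
move=> oM.
pose small (t : set X) (r : K) := [/\ open t, 0 < r &
  exists x, t `<=` ball x r /\ exists2 v, M v & ball x (3 * r) `<=` v].
exists [set t | exists r, small t r]; split.
- by move=> t [r []].
- move=> x [v Mv vx].
  have /nbhs_ballP [e /= e0 ev] : nbhs x v.
    by apply: open_nbhs_nbhs; split; [exact: oM|].
  have e3 : 0 < e / 3 by rewrite divr_gt0.
  exists (ball x (e / 3))°; last exact: nbhsx_ballx e3.
  exists (e / 3); split=> //; first exact: open_interior.
  exists x; split; first exact: interior_subset.
  by exists v => //; rewrite mulrC divfK ?pnatr_eq0.
move=> n s [sn sS [x sx]].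
have /choice [r rP] (t : set X) : exists r : K,
    (exists r, small t r) -> small t r.
  have [[r tr]|nr] := pselect (exists r, small t r); last by exists 0.
  by exists r.
have s0 : s != [::] by case: s sn {sS sx}.
have [t ts tmax] := seq_argmax r s0.
have [_ t0 [y [ty [v Mv yv]]]] := rP _ (sS _ ts).
exists v => // w ws z wz; apply: yv.
have [_ w0 [y' [wy' _]]] := rP _ (sS _ ws).
have := ball_triangle (ty _ (sx _ ts)) (ball_sym (wy' _ (sx _ ws))).
move=> /ball_triangle /(_ (wy' _ wz)).
by apply: le_ball; have := tmax _ ws; lra.
Qed.

(** A Lebesgue number argument: compactness of [[0, 1]] gives one [d] that works in space and time
    at every instant, and [2 ^ k] equal steps are shorter than [d]. *)
Lemma homotopy_track (H : X * K -> X) A U a :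
  {within A `*` `[0, 1], continuous H} -> open_cover U -> A a ->
  exists (k : nat) (u : nat -> set X) (r : K),
    [/\ 0 < r, forall j, (j < 2 ^ k)%N -> U (u j) &
        forall x (j : nat) t, A x -> ball a r x -> (j < 2 ^ k)%N ->
          j%:R <= t * 2 ^+ k <= j.+1%:R -> u j (H (x, t))].
Proof.
move=> cH [oU cU] Aa.
pose good (d t : K) := exists2 v, U v & forall x s, A x -> `[0, 1]%classic s ->
  ball a d x -> ball t d s -> v (H (x, s)).
have : \forall d \near (0 : K)^'+, `[0, 1] `<=` good d.
  apply: (compact_near_coveringP _).1; first exact: segment_compact.
  move=> t It.
  have [v Uv vt] : (\bigcup_(v in U) v) (H (a, t)) by rewrite cU.
  have /(_ v) : H x @[x --> within (A `*` `[0, 1]) (nbhs (a, t))] --> H (a, t).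
    by apply: (subspace_continuousP _ _).1.
  move=> /(_ (open_nbhs_nbhs (conj (oU _ Uv) vt))) /nbhs_ballP [e /= e0 ev].
  have e2 : 0 < e / 2 by rewrite divr_gt0.
  near=> t' d.
  have d2 : d < e / 2 by near: d; exact: nbhs_right_lt.
  have t2 : ball t (e / 2) t' by near: t'; exact: nbhsx_ballx e2.
  exists v => // x s Ax Is /= ax t's; apply: (ev (x, s)) => //; split=> /=.
    by apply: le_ball ax; lra.
  have := ball_triangle t2 t's; apply: le_ball; lra.
move=> /(@filterI _ _ _ _ _ (nbhs_right_gt 0)) /filter_ex [d [/= d0 dgood]].
have [k kd] : exists k, d^-1 < 2 ^+ k :> K.
  exists (Num.truncn d^-1).+1; rewrite (lt_trans (truncnS_gt _)) //.
  rewrite -natrX ltr_nat.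
  exact: ltn_expl.
have k0 : 0 < 2 ^+ k :> K by rewrite exprn_gt0.
have /choice [u uP] (j : nat) : exists v, (j < 2 ^ k)%N -> U v /\
    forall x s, A x -> `[0, 1]%classic s -> ball a d x ->
    ball (j%:R / 2 ^+ k : K) d s -> v (H (x, s)).
  have [jk|] := boolP (j < 2 ^ k)%N; last by exists set0.
  have [|v Uv vP] := dgood (j%:R / 2 ^+ k); last by exists v.
  rewrite /= in_itv /= divr_ge0 ?ler0n ?(ltW k0) //= ler_pdivrMr // mul1r.
  rewrite -natrX ler_nat.
  exact: ltnW.
exists k, u, d; split=> // [j /uP[]//|x j t Ax ax jk /andP[jt tj]].
have [_] := uP _ jk; apply=> //.
  rewrite /= in_itv /= -(ler_pM2r k0) mul0r (le_trans _ jt) ?ler0n //=.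
  by rewrite -(ler_pM2r k0) mul1r (le_trans tj) // -natrX ler_nat.
have -> : t = j%:R / 2 ^+ k + (t * 2 ^+ k - j%:R) / 2 ^+ k.
  by field; rewrite gt_eqF.
rewrite /ball /= opprD addNKr normrN ger0_norm.
  rewrite ltr_pdivrMr // (@le_lt_trans _ _ 1) //.
    by rewrite lerBlDr addrC natr1.
  by rewrite mulrC -ltr_pdivrMr // mul1r.
by rewrite divr_ge0 ?subr_ge0 // ltW.
Unshelve. all: by end_near.
Qed.

(** The refinement map is the start of the tracks. [path_coboundary] compares it with their end,
    contiguity compares the end with the constant [y0], and a constant map kills positive degree. *)
Lemma contractible_coboundary A U n (c : seq (set X) -> R) :
  contractible_in K A -> (0 < n)%N -> open_cover U -> is_cocycle U n c ->
  exists V p, [/\ forall v, V v -> open v, A `<=` \bigcup_(v in V) v,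
    refinement_map V U p & is_coboundary V n (c \o map p)].
Proof.
move=> [f [fc [H [cH H0 H1]]]] n0 cU cc.
have [[a0 Aa0]|A0] := pselect (A !=set0); last first.
  exists set0, id; split=> // [a Aa|]; first by case: A0; exists a.
  case: n n0 cc => // n _ _; exists (fun=> 0) => -[[]|w s [_ sV _]] //.
  by have := sV w (mem_head _ _).
have [y0 Uy0 y0f] : (\bigcup_(u in U) u) (f a0) by rewrite cU.2.
pose good (w : set X) (d : nat * (nat -> set X) * K) :=
  let: (k, u, r) := d in
  [/\ open w, w `<=` u 0%N, 0 < r, forall j, (j < 2 ^ k)%N -> U (u j) &
    exists a, [/\ A a, w `<=` ball a r & forall x (j : nat) t,
      A x -> ball a (2 * r) x -> (j < 2 ^ k)%N ->
      j%:R <= t * 2 ^+ k <= j.+1%:R -> u j (H (x, t))]].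
pose V := [set w | exists d, good w d].
have /choice [D DP] (w : set X) : exists d, V w -> good w d.
  have [[d wd]|nw] := pselect (V w); first by exists d.
  by exists (0%N, fun=> set0, 0).
pose k w := (D w).1.1; pose u w := (D w).1.2; pose r w := (D w).2.
have Dgood w : V w -> good w (k w, u w, r w).
  by move=> /DP; rewrite /k /u /r; case: (D w) => -[].
have uU w j : V w -> (j < 2 ^ k w)%N -> U (u w j).
  by move=> /Dgood [_ _ _ + _]; apply.
(* The centre of the smallest ball of a simplex lies within twice the radius
   of each of its vertices; its track serves all of them. *)
have track s : nerve_simplex V n s -> exists2 a, A a &
    forall w (j : nat) t, w \in s -> (j < 2 ^ k w)%N ->
      j%:R <= t * 2 ^+ k w <= j.+1%:R -> u w j (H (a, t)).
  move=> [sn sV [x sx]].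
  have s0 : s != [::] by case: s sn {sV sx}.
  have [w ws wmin] := seq_argmax (fun w => - r w) s0.
  have [_ _ _ _ [a [Aa wa _]]] := Dgood _ (sV _ ws).
  exists a => // v j t vs jk jt.
  have [_ _ _ _ [b [_ vb bP]]] := Dgood _ (sV _ vs); apply: bP => //.
  have := ball_triangle (vb _ (sx _ vs)) (ball_sym (wa _ (sx _ ws))).
  by apply: le_ball; have := wmin _ vs; lra.
have V0 w : (0 < 2 ^ k w)%N by rewrite expn_gt0.
exists V, (u^~ 0%N); split.
- by move=> v /Dgood [].
- move=> a Aa; have [l [v [e [e0 vU vP]]]] := homotopy_track cH cU Aa.
  have e2 : 0 < e / 2 by rewrite divr_gt0.
  have v0 : v 0%N a.
    have <- : H (a, 0) = a by rewrite H0.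
    apply: vP; [by []|exact: ballxx|by rewrite expn_gt0|].
    by rewrite mul0r lexx ler01.
  (* Meeting with [v 0%N] makes time 0 a refinement map; halving [e] keeps the track valid on twice
     the radius. *)
  exists ((ball a (e / 2))° `&` v 0%N); last first.
    by split=> //; exact: nbhsx_ballx e2.
  exists (l, v, e / 2); split=> //.
  - apply: openI; first exact: open_interior.
    by apply: cU.1; apply: vU; rewrite expn_gt0.
  - exists a; split=> // [x [/interior_subset]//|x j t Ax].
    by rewrite mulrC divfK ?pnatr_eq0 //; exact: vP.
- by move=> w Vw; split; [exact: uU|have [] := Dgood _ Vw].
have last_lt w : ((2 ^ k w).-1 < 2 ^ k w)%N by rewrite ltn_predL.
have b1 : is_coboundary V n
    (fun s => c (map (fun w => u w (2 ^ k w).-1) s) - c (map (u^~ 0%N) s)).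
  apply: (path_coboundary (K := K)) cc => // s /track [a _ aP].
  by exists (fun t => H (a, t)) => w j t; exact: aP.
have b2 : is_coboundary V n (fun s => c (map (fun=> y0) s) -
    c (map (fun w => u w (2 ^ k w).-1) s)).
  apply: contiguous_coboundary cc => [w Vw|s /track [a Aa aP]].
    by split=> //; exact: uU.
  (* At time 1, the right end of the last step, the track of [a] is at [f a = f a0], a point of
     [y0]. *)
  exists (f a0) => w ws; split=> //.
  rewrite -(fc a) // -H1 //; apply: aP => //.
  by rewrite mul1r prednK // -natrX lexx ler_nat leq_pred.
have b3 := is_coboundary_const V Uy0 (ex_intro _ _ y0f) n0 cc.
have := is_coboundaryB (is_coboundaryB b3 b2) b1.
by apply: is_coboundary_ext => s _ /=; ring.
Qed.

End Metric.

(** * Relative cup products *)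

Section Cup.
Context {X : topologicalType} {R : comPzRingType}.
Implicit Types (U V T : set (set X)) (c e : seq (set X) -> R).

(* A cochain trivialising [c] on [T] is defined on all sequences of vertices, so
   it can be subtracted from [c] globally. *)
Lemma relative_cocycle V T n c :
  is_cocycle V n c -> is_coboundary T n c ->
  exists c', [/\ is_cocycle V n c', is_coboundary V n (fun s => c s - c' s) &
    forall s, nerve_simplex T n s -> c' s = 0].
Proof.
move=> cc /is_coboundaryP [b [b0 bc]].
exists (fun s => c s - coboundary b s); split=> [s ss||s ss].
- by rewrite coboundaryB coboundaryK cc // subrr.
- apply/is_coboundaryP; exists b; split=> // s _; ring.
- by rewrite bc // subrr.
Qed.

(** Corrected by coboundaries, [c] vanishes on [T1] and [e] on [T2]. Faces of a simplex stay in the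
    same family, so one factor of the product is always 0. *)
Lemma is_coboundary_cup_cover V T1 T2 n m c e :
  is_cocycle V n c -> is_cocycle V m e ->
  is_coboundary T1 n c -> is_coboundary T2 m e ->
  (forall s, nerve_simplex V (n + m) s ->
    nerve_simplex T1 (n + m) s \/ nerve_simplex T2 (n + m) s) ->
  is_coboundary V (n + m) (cup_cochain n c e).
Proof.
move=> cc ce bc be V12.
have [c' [cc' bc' c'0]] := relative_cocycle cc bc.
have [e' [ce' be' e'0]] := relative_cocycle ce be.
have := is_coboundary_cupB cc' ce bc' be'.
apply: is_coboundary_ext => s /V12 s12; rewrite /cup_cochain.
rewrite [X in _ - X](_ : _ = 0) ?subr0 //.
case: s12 => ss.
  by rewrite c'0 ?mul0r //; apply: nerve_simplex_take ss _; exact: leq_addr.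
by rewrite e'0 ?mulr0 //; apply: nerve_simplex_drop ss _.
Qed.

(** Passing through [V] gives another refinement map from [T] to [U], and two such maps differ by a
    coboundary on the cocycle [c]. *)
Lemma is_coboundary_refine V T U p q n c :
  (forall t, T t -> exists2 v, V v & t `<=` v) ->
  refinement_map V U p -> refinement_map T U q -> is_cocycle U n c ->
  is_coboundary V n (c \o map p) -> is_coboundary T n (c \o map q).
Proof.
move=> TV rp rq cc bc.
have /choice [g gP] (t : set X) : exists v, T t -> V v /\ t `<=` v.
  have [/TV [v Vv tv]|nT] := pselect (T t); first by exists v.
  by exists set0.
have rg : refinement_map T V g by move=> t /gP.
have := is_coboundaryD (is_coboundary_map rg bc)
  (refinement_unique rq (refinement_comp rg rp) cc).
by apply: is_coboundary_ext => s _ /=; rewrite map_comp addrC subrK.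
Qed.

End Cup.

(** * Cohomology classes vanishing near a subset *)

Section ClassKilled.
Context {K : realType} {X : pseudoMetricType K} {R : comPzRingType}.
Implicit Types (A B : set X).

Definition vanishes_near A (a : hclass X R) : Prop :=
  exists x : cech_rep X R (hdeg a), \pi_(cech X R (hdeg a)) x = projT2 a /\
  exists V p, [/\ forall v, V v -> open v, A `<=` \bigcup_(v in V) v,
    refinement_map V (rep_cover x) p &
    is_coboundary V (hdeg a) (rep_cochain x \o map p)].

Lemma vanishes_near_contractible A (a : hclass X R) :
  contractible_in K A -> (0 < hdeg a)%N -> vanishes_near A a.
Proof.
case: a => n a cA n0; exists (repr a); split; first exact: reprK.
exact: contractible_coboundary (rep_coverP _) (rep_cocycleP _).
Qed.

Lemma vanishes_near_cup A B (a b : hclass X R) :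
  vanishes_near A a -> vanishes_near B b -> vanishes_near (A `|` B) (hcup a b).
Proof.
case: a b => n a [m b] [x [/= xa [V [p [oV AV rp bV]]]]].
move=> [y [/= yb [V' [p' [oV' BV' rp' bV']]]]].
exists (cup_rep x y); split; first by rewrite /= -cech_cup_pi xa yb.
have [|S [oS VS starS]] := @star_refinement K X (V `|` V').
  by move=> v [/oV|/oV'].
pose C := rep_cover (cup_rep x y); pose W := meet_cover S C.
have [oC cC] : open_cover C := rep_coverP (cup_rep x y).
have rS : refinement_map W S (meet_left S C) by exact: meet_leftP.
have rC : refinement_map W C (meet_right S C) by exact: meet_rightP.
exists W, (meet_right S C); split=> //.
- by move=> _ [s Ss [d Cd <-]]; apply: openI; [exact: oS|exact: oC].
- move=> z zAB; have [|s Ss sz] := VS z.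
    case: zAB => [/AV|/BV'] [v Vv vz]; exists v => //; [by left|by right].
  have [d Cd dz] : (\bigcup_(d in C) d) z by rewrite cC.
  by exists (s `&` d) => //; exists s => //; exists d.
have rx := refinement_comp rC (@meet_leftP X (rep_cover x) (rep_cover y)).
have ry := refinement_comp rC (@meet_rightP X (rep_cover x) (rep_cover y)).
(* By [starS], a simplex of [W] lies in a single member of [V] or [V'], so its vertices are all in
   [sub V] or all in [sub V']. *)
pose sub (M : set (set X)) := [set w | W w /\ exists2 v, M v & w `<=` v].
have subr M U q : refinement_map W U q -> refinement_map (sub M) U q.
  by move=> r w [/r].
have subM M w : sub M w -> exists2 v, M v & w `<=` v by case.
apply: is_coboundary_ext (is_coboundary_cup_cover
  (is_cocycle_map rx (rep_cocycleP x)) (is_cocycle_map ry (rep_cocycleP y))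
  (is_coboundary_refine (subM V) rp (subr _ _ _ rx) (rep_cocycleP x) bV)
  (is_coboundary_refine (subM V') rp' (subr _ _ _ ry) (rep_cocycleP y) bV') _).
  by move=> s _; rewrite /= /cup_cochain /= -!map_take -!map_drop -!map_comp.
move=> s ss; have [sn sW sx] := ss.
have [v Vv vs] := starS _ _ (nerve_simplex_map rS ss).
have sv w : w \in s -> w `<=` v.
  move=> ws; have [_ wS] := rS _ (sW _ ws); apply: subset_trans wS _.
  by apply: vs; exact: map_f.
by case: Vv => Vv; [left|right]; split=> // w ws; split; first [exact: sW |
  by exists v; [|exact: sv]].
Qed.

Lemma vanishes_near_setT (a : hclass X R) :
  vanishes_near setT a -> projT2 a = cech0 (hdeg a).
Proof.
case: a => n a [x [/= <- [V [p [oV cV rp bV]]]]].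
(* The zero class lives on the cover by [setT] alone, so the constant map is the refinement map. *)
apply/cech_eqP; exists V, p, (fun=> setT); split=> //.
- by split=> //; apply/seteqP; split.
- by apply: is_coboundary_ext bV => s _; rewrite /= subr0.
Qed.

Lemma vanishes_near_foldl (I : choiceType) (l : seq I) (F : I -> set X)
    (G : I -> hclass X R) A a :
  vanishes_near A a -> (forall i, vanishes_near (F i) (G i)) ->
  vanishes_near (A `|` \bigcup_(i in [set` l]) F i)
    (foldl (@hcup X R) a (map G l)).
Proof.
move=> + FG; elim: l A a => [|i l IHl] A a Aa /=.
  by rewrite bigcup_seq big_nil setU0.
rewrite bigcup_seq big_cons -bigcup_seq setUA.
by apply: IHl; exact: vanishes_near_cup.
Qed.

Lemma hcup_prod_eq0 k (A : 'I_k.+1 -> set X) (a : 'I_k.+1 -> hclass X R) :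
  (forall i, contractible_in K (A i)) -> \bigcup_i A i = setT ->
  (forall i, 0 < hdeg (a i))%N ->
  projT2 (hcup_prod a) = cech0 (hdeg (hcup_prod a)).
Proof.
move=> cA AT da; apply: vanishes_near_setT; rewrite -AT.
have van i : vanishes_near (A i) (a i) by exact: vanishes_near_contractible.
suff -> : \bigcup_i A i =
    A ord0 `|` \bigcup_(i in [set` enum 'I_k]) A (lift ord0 i).
  by apply: vanishes_near_foldl => // i; exact: van.
apply/seteqP; split=> [x [i _]|x [?|[i _ ?]]]; last 2 first.
- by exists ord0.
- by exists (lift ord0 i).
have [j ->|->] := unliftP ord0 i; last by left.
by right; exists j => //; rewrite /= mem_enum.
Qed.

End ClassKilled.

(** * From category to cup-length *)

Lemma least_mem (P : set nat) m :
  enat_le (least P) m -> exists2 k, P k & (k <= m)%N.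
Proof.
rewrite /least; case: pselect => //= exP.
by case: ex_minnP => k /asboolP Pk _ km; exists k.
Qed.

Lemma least_le (P : set nat) k m : P k -> (k <= m)%N -> enat_le (least P) m.
Proof.
move=> Pk km; rewrite /least; case: pselect => [exP|[]] /=; last first.
  by exists k; apply/asboolP.
by case: ex_minnP => l _ lmin; rewrite (leq_trans (lmin k _)) //; apply/asboolP.
Qed.

Theorem theorem5p2 (K : realType) (X : metricType K) (m : nat) :
  compact [set: X] ->
  enat_le (cat_g K X) m ->
  forall R : comPzRingType, enat_le (cup_length R X) m.
Proof.
(* The same [k <= m] that bounds the category serves for the cup-length. *)
move=> _ /least_mem [k [A [cA AT]] km] R; apply: least_le km => a da.
exact: hcup_prod_eq0 cA AT da.
Qed.
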